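(* Let $\mathbb{H}_3$ be the $3$-dimensional Heisenberg group with Lie algebra $\mathfrak{h}_3$, let $\{X_1,X_2,X_3\}$ be the basis of $\mathfrak{h}_3$ with $[X_1,X_2]=X_3$, $[X_1,X_3]=[X_2,X_3]=0$, and let $\{\omega_1,\omega_2,\omega_3\}$ be its dual basis. Every $\mathbb{Z}_2^2$-symmetric Riemannian structure on $\mathbb{H}_3$ is isometric to a $\mathbb{Z}_2^2$-symmetric Riemannian structure associated with the grading $$\mathfrak{h}_3=\{0\}\oplus \mathbb{R}X_1\oplus \mathbb{R}X_2\oplus \mathbb{R}X_3$$ whose metric is the left-invariant metric $$g=\omega_1^2+\omega_2^2+\lambda^2\omega_3^2$$ for some real $\lambda\neq 0$.
   Context: $\mathbb{H}_3$ is the group of real upper triangular unipotent $3\times 3$ matrices. A subgroup $\Gamma\subset \mathrm{Aut}(\mathfrak{h}_3)$ isomorphic to $\mathbb{Z}_2^2=(\mathbb{Z}/2\mathbb{Z})^2$ consists of commuting involutive automorphisms, and its simultaneous eigenspace decomposition is a $\mathbb{Z}_2^2$-grading $\mathfrak{h}_3=\bigoplus_{\gamma\in\mathbb{Z}_2^2}\mathfrak{g}_\gamma$ with $[\mathfrak{g}_\gamma,\mathfrak{g}_{\gamma'}]\subset\mathfrak{g}_{\gamma\gamma'}$, where $\mathfrak{g}_\epsilon$ ($\epsilon$ the unit of $\mathbb{Z}_2^2$) is the space of vectors fixed by $\Gamma$. A $\mathbb{Z}_2^2$-symmetric structure on $\mathbb{H}_3=\mathbb{H}_3/\{e\}$ is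 the structure given by such a grading (with $\mathfrak{g}_\epsilon=\{0\}$, so the isotropy subgroup $H$ is trivial). A $\mathbb{Z}_2^2$-symmetric Riemannian structure on $\mathbb{H}_3$ is such a grading together with a left-invariant Riemannian metric $g$ on $\mathbb{H}_3$ whose associated inner product on $\mathfrak{h}_3$ makes the components $\mathfrak{g}_\gamma$, $\gamma\neq\epsilon$, pairwise orthogonal. Left-invariant metrics on $\mathbb{H}_3$ are identified with the corresponding bilinear forms on $\mathfrak{h}_3$. *)

(* Defs.v *)
From HB Require Import structures.
From mathcomp Require Import all_boot all_order all_algebra.
From mathcomp Require Import sesquilinear ring.
From mathcomp Require Import all_classical all_reals all_analysis.

Set Implicit Arguments.
Unset Strict Implicit.
Unset Printing Implicit Defensive.

Import Order.TTheory GRing.Theory Num.Theory.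
Import numFieldNormedType.Exports.

Local Open Scope ring_scope.

(* Z_2^2 is written additively, so that its unit is 0. *)
Notation Z22 := ('Z_2 * 'Z_2)%type.

Section Heisenberg.
Variable R : realType.

(* Both the group H_3 and its Lie algebra h_3 are carried by 'rV[R]_3.  A row
   (x, y, z) is the global coordinate of the unipotent matrix

     1 x z
     0 1 y
     0 0 1

   when read in H_3, and of the same matrix with zero diagonal when read in
   h_3.  The tangent space of H_3 at any point is then 'rV[R]_3 as well. *)

Definition h3_mx (v : 'rV[R]_3) : 'M[R]_3 :=
  v 0 0 *: delta_mx 0 1 + v 0 1 *: delta_mx 1 2 + v 0 2 *: delta_mx 0 2.

Definition h3_coord (A : 'M[R]_3) : 'rV[R]_3 :=
  A 0 1 *: 'e_0 + A 1 2 *: 'e_1 + A 0 2 *: 'e_2.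

Definition H3_mx (p : 'rV[R]_3) : 'M[R]_3 := 1%:M + h3_mx p.

Definition H3_mul (p q : 'rV[R]_3) : 'rV[R]_3 :=
  h3_coord (H3_mx p *m H3_mx q).

Definition H3_inv (p : 'rV[R]_3) : 'rV[R]_3 := h3_coord (invmx (H3_mx p)).

Definition h3_bracket (u v : 'rV[R]_3) : 'rV[R]_3 :=
  h3_coord (h3_mx u *m h3_mx v - h3_mx v *m h3_mx u).

Definition X1 : 'rV[R]_3 := 'e_0.
Definition X2 : 'rV[R]_3 := 'e_1.
Definition X3 : 'rV[R]_3 := 'e_2.

(* The dual basis: the i-th coordinate form. *)
Definition omega1 (v : 'rV[R]_3) : R := v 0 0.
Definition omega2 (v : 'rV[R]_3) : R := v 0 1.
Definition omega3 (v : 'rV[R]_3) : R := v 0 2.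

Definition h3_automorphism (f : 'End('rV[R]_3)) : Prop :=
  bijective f /\ (forall u v, f (h3_bracket u v) = h3_bracket (f u) (f v)).

(* The standard self-duality of Z_2^2, used to index the simultaneous
   eigenspaces of a group isomorphic to Z_2^2 by Z_2^2 itself. *)
Definition Z22_char (gamma delta : Z22) : R :=
  (-1) ^+ nat_of_ord (gamma.1 * delta.1 + gamma.2 * delta.2)%R.

Definition Z22_grading (g : Z22 -> {vspace 'rV[R]_3}) : Prop :=
  [/\ (\sum_gamma g gamma)%VS = fullv,
      directv (\sum_gamma g gamma)%VS &
      forall gamma gamma' u v, u \in g gamma -> v \in g gamma' ->
        h3_bracket u v \in g (gamma + gamma')].

(* rho is an isomorphism of Z_2^2 onto a subgroup Gamma of Aut(h_3). *)
Definition Z22_embedding (rho : Z22 -> 'End('rV[R]_3)) : Prop :=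
  [/\ forall gamma, h3_automorphism (rho gamma),
      forall gamma delta, rho (gamma + delta) = (rho gamma \o rho delta)%VF &
      injective rho].

Definition simultaneous_eigenspaces (rho : Z22 -> 'End('rV[R]_3))
    (g : Z22 -> {vspace 'rV[R]_3}) : Prop :=
  forall gamma v, v \in g gamma <->
    (forall delta, rho delta v = Z22_char gamma delta *: v).

(* A Z_2^2-symmetric structure on H_3 = H_3 / {e}. *)
Definition Z22_symmetric (g : Z22 -> {vspace 'rV[R]_3}) : Prop :=
  [/\ Z22_grading g,
      exists rho, Z22_embedding rho /\ simultaneous_eigenspaces rho g &
      g 0 = 0%VS].

(* The left-invariant metric is given by its inner product on h_3. *)
Record Z22_symmetric_riemannian := {
  grading : Z22 -> {vspace 'rV[R]_3};
  metric : {dot 'rV[R]_3 for idfun};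
  gradingP : Z22_symmetric grading;
  metric_orthogonal : forall gamma gamma' u v,
    gamma != 0 -> gamma' != 0 -> gamma != gamma' ->
    u \in grading gamma -> v \in grading gamma' -> metric u v = 0 }.

(* Left translation of a tangent vector at p back to the unit. *)
Definition maurer_cartan (p v : 'rV[R]_3) : 'rV[R]_3 :=
  'd (H3_mul (H3_inv p)) p v.

Definition left_invariant_metric (b : 'rV[R]_3 -> 'rV[R]_3 -> R)
    (p v w : 'rV[R]_3) : R :=
  b (maurer_cartan p v) (maurer_cartan p w).

(* C^n, through directional derivatives of the differential; in finite
   dimension this is the usual notion. *)
Fixpoint class_C (n : nat) (f : 'rV[R]_3 -> 'rV[R]_3) : Prop :=
  if n is m.+1 then
    (forall p, differentiable f p) /\
    (forall v, class_C m (fun p => 'd f p v))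
  else continuous f.

Definition smooth (f : 'rV[R]_3 -> 'rV[R]_3) : Prop := forall n, class_C n f.

Definition diffeomorphism (f : 'rV[R]_3 -> 'rV[R]_3) : Prop :=
  smooth f /\ exists f', [/\ cancel f f', cancel f' f & smooth f'].

(* A Riemannian isometry of H_3 which maps the left-invariant splitting of the
   tangent bundle defined by the first grading onto the one defined by the
   second.  Since Gamma is a subgroup of Aut(h_3) which is only abstractly
   isomorphic to Z_2^2, components are matched up to an automorphism sigma of
   Z_2^2. *)
Definition isometric (S S' : Z22_symmetric_riemannian) : Prop :=
  exists f : 'rV[R]_3 -> 'rV[R]_3,
    [/\ diffeomorphism f,
        forall p v w,
          left_invariant_metric (metric S') (f p) ('d f p v) ('d f p w) =
          left_invariant_metric (metric S) p v w &
        exists sigma : Z22 -> Z22,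
          [/\ bijective sigma, {morph sigma : gamma delta / gamma + delta} &
              forall p gamma v,
                (maurer_cartan (f p) ('d f p v) \in grading S' (sigma gamma)) =
                (maurer_cartan p v \in grading S gamma)]].

(* h_3 = {0} + R X1 + R X2 + R X3, indexed by 0, a, b, a + b. *)
Definition standard_grading (gamma : Z22) : {vspace 'rV[R]_3} :=
  if gamma == (1, 0) then <[X1]>%VS
  else if gamma == (0, 1) then <[X2]>%VS
  else if gamma == (1, 1) then <[X3]>%VS
  else 0%VS.

Lemma h3_mxK : cancel h3_mx h3_coord.
Proof.
move=> v; apply/rowP => i; rewrite /h3_coord /h3_mx !mxE /=.
case: i => -[|[|[|//]]] Hi; rewrite /= ?(mulr1, mulr0, addr0, add0r);
  congr (v _ _); exact/val_inj.
Qed.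

Lemma H3_mxM p q : H3_mx (H3_mul p q) = H3_mx p *m H3_mx q.
Proof.
apply/matrixP => i j.
rewrite /H3_mul /H3_mx /h3_coord /h3_mx !mxE !big_ord_recl !big_ord0 !mxE /=.
case: i => -[|[|[|//]]] Hi; case: j => -[|[|[|//]]] Hj;
  rewrite /= ?(mulr1, mulr0, mul1r, mul0r, addr0, add0r) //.
Qed.

Lemma H3_mxK : cancel H3_mx h3_coord.
Proof.
move=> v; rewrite -[RHS]h3_mxK /h3_coord /H3_mx.
by rewrite !(@mxE _ _ _ _ (fun i j => _ + _)) !mxE /= !add0r.
Qed.

Lemma H3_mxV p : H3_mx (H3_inv p) = invmx (H3_mx p).
Proof.
pose q : 'rV[R]_3 :=
  - p 0 0 *: 'e_0 - p 0 1 *: 'e_1 + (p 0 0 * p 0 1 - p 0 2) *: 'e_2.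
have pq1 : H3_mx p *m H3_mx q = 1%:M.
  rewrite -H3_mxM (_ : H3_mul p q = 0).
    by rewrite /H3_mx /h3_mx !mxE !scale0r !addr0.
  apply/rowP => i.
  rewrite /H3_mul /H3_mx /h3_coord /h3_mx !mxE !big_ord_recl !big_ord0 !mxE /=.
  case: i => -[|[|[|//]]] Hi;
    rewrite /= ?(mulr1, mulr0, mul1r, mul0r, addr0, add0r); ring.
have [pu _] := mulmx1_unit pq1.
have -> : invmx (H3_mx p) = H3_mx q.
  by rewrite -[RHS](mulKmx pu) pq1 mulmx1.
rewrite /H3_inv; congr H3_mx.
have -> : invmx (H3_mx p) = H3_mx q.
  by rewrite -[RHS](mulKmx pu) pq1 mulmx1.
exact: H3_mxK.
Qed.

Lemma h3_bracketE u v :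
  h3_bracket u v = (u 0 0 * v 0 1 - u 0 1 * v 0 0) *: X3.
Proof.
apply/rowP => i.
rewrite /h3_bracket /h3_coord /h3_mx /X3 !mxE !big_ord_recl !big_ord0 !mxE /=.
case: i => -[|[|[|//]]] Hi;
  rewrite /= ?(mulr1, mulr0, mul1r, mul0r, addr0, add0r); ring.
Qed.

Lemma h3_bracketX :
  [/\ h3_bracket X1 X2 = X3, h3_bracket X1 X3 = 0 & h3_bracket X2 X3 = 0].
Proof.
by split; rewrite h3_bracketE !mxE /= ?(mulr1, mulr0, mul0r, subr0) ?scale1r ?scale0r.
Qed.

End Heisenberg.

(* Main.v *)
Require Import Defs.
From HB Require Import structures.
From mathcomp Require Import all_boot all_order all_algebra.
From mathcomp Require Import sesquilinear zify ring lra.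
From mathcomp Require Import all_classical all_reals all_analysis.
Import Order.TTheory GRing.Theory Num.Theory.
Import numFieldNormedType.Exports.
Local Open Scope ring_scope.

Set Implicit Arguments.
Unset Strict Implicit.
Unset Printing Implicit Defensive.

(** A grading with trivial unit component is very rigid.  The bracket of h_3 is
    not zero and homogeneous vectors span, so some homogeneous u and v have
    [u, v] != 0.  Their degrees a and b are non-zero because g_0 = 0, and they
    are distinct because [u, v] has degree a + b, which must be non-zero too.
    Hence a, b and a + b are the three non-zero elements of Z_2^2, each of the
    three components contains one of u, v, [u, v], and a dimension count shows
    that each component is the line spanned by it ([adapted_frame]).

    Orthogonality of the components makes (u, v, [u, v]) orthogonal, and u and v
    may be rescaled to unit vectors, after which [u, v] is recomputed
    ([orthonormal_adapted_frame]).  The linear map X1 |-> u, X2 |-> v,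
    X3 |-> [u, v] ([frame]) is then an automorphism of the Lie algebra which
    carries the standard grading to the given one.  It pulls the metric back to
    omega1^2 + omega2^2 + lambda^2 omega3^2, where lambda is the norm of [u, v]:
    this norm cannot be normalised away, as the bracket determines the third
    vector from the first two.

    It remains to pass from the Lie algebra to the group.  As H_3 is nilpotent
    of class 2, exp and log are global polynomial diffeomorphisms, and an
    automorphism phi integrates to exp o phi o log ([integrate]).  This map is
    quadratic, hence smooth, and its differential, read through the
    Maurer-Cartan form, is phi at every point ([maurer_cartan_integrate]).  So
    whatever phi preserves on h_3 is preserved by the integrated map as a
    left-invariant structure on H_3 ([lie_automorphism_isometric]).

    The standard grading must also be shown to come from a subgroup of
    Aut(h_3), namely that of the diagonal sign changes
    ([standard_embedding]). *)

(** * The group Z_2^2 and its characters *)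

Lemma Z2P (a : 'Z_2) : a = 0 \/ a = 1.
Proof. by case: a => -[|[|//]] i; [left|right]; exact/val_inj. Qed.

Lemma Z22P (g : Z22) : [\/ g = 0, g = (1, 0), g = (0, 1) | g = (1, 1)].
Proof.
case: g => a b; case: (Z2P a) => ->; case: (Z2P b) => ->.
- exact: Or41. - exact: Or43. - exact: Or42. - exact: Or44.
Qed.

Lemma Z22_addxx (g : Z22) : g + g = 0.
Proof. by case: (Z22P g) => ->; congr (_, _); exact/val_inj. Qed.

Section Reindexing.
Variables a b : Z22.
Hypotheses (a0 : a != 0) (b0 : b != 0) (ab : a != b).

(** Distinct non-zero a and b form a basis of Z_2^2 over the field with two
    elements; the coordinates in it are given by Cramer's rule, where the
    determinant of (a, b) is 1. *)
Definition Z22_coord (d : Z22) : Z22 :=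
  (d.1 * b.2 - d.2 * b.1, a.1 * d.2 - a.2 * d.1).

Definition Z22_combine (s : Z22) : Z22 :=
  (s.1 * a.1 + s.2 * b.1, s.1 * a.2 + s.2 * b.2).

Lemma Z22_det1 : a.1 * b.2 - a.2 * b.1 = 1.
Proof.
move: a0 b0 ab.
by case: (Z22P a) => ->; case: (Z22P b) => -> //= _ _ _; exact/val_inj.
Qed.

Lemma Z22_coordK : cancel Z22_coord Z22_combine.
Proof.
case=> x y; rewrite /Z22_combine /=; congr (_, _).
  by rewrite -[RHS]mulr1 -Z22_det1; ring.
by rewrite -[RHS]mulr1 -Z22_det1; ring.
Qed.

Lemma Z22_combineK : cancel Z22_combine Z22_coord.
Proof.
case=> x y; rewrite /Z22_coord /=; congr (_, _).
  by rewrite -[RHS]mulr1 -Z22_det1; ring.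
by rewrite -[RHS]mulr1 -Z22_det1; ring.
Qed.

Lemma Z22_combineE :
  [/\ Z22_combine 0 = 0, Z22_combine (1, 0) = a, Z22_combine (0, 1) = b &
      Z22_combine (1, 1) = a + b].
Proof.
split; rewrite /Z22_combine /= ?mul1r ?mul0r ?addr0 ?add0r //.
- exact/esym/surjective_pairing.
- exact/esym/surjective_pairing.
Qed.

Lemma Z22_coordD : {morph Z22_coord : c d / c + d}.
Proof. by move=> c d; rewrite /Z22_coord; congr (_, _) => /=; ring. Qed.

End Reindexing.

Section Characters.
Variable R : realType.

Lemma Z22_charD g d d' :
  Z22_char R g (d + d') = Z22_char R g d * Z22_char R g d'.
Proof.
have Z2_sign (a b : 'Z_2) : (-1) ^+ (a + b)%R = (-1) ^+ a * (-1) ^+ b :> R.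
  by case: (Z2P a) => ->; case: (Z2P b) => -> /=; rewrite ?expr0 ?expr1; ring.
by rewrite /Z22_char -Z2_sign; congr (_ ^+ nat_of_ord _) => /=; ring.
Qed.

Lemma Z22_charC g d : Z22_char R g d = Z22_char R d g.
Proof. by rewrite /Z22_char [d.1 * _]mulrC [d.2 * _]mulrC. Qed.

Lemma Z22_char0 g : Z22_char R g 0 = 1.
Proof. by rewrite /Z22_char !mulr0 addr0 expr0. Qed.

Lemma Z22_char_inj2 g g' :
  Z22_char R (1, 0) g = Z22_char R (1, 0) g' ->
  Z22_char R (0, 1) g = Z22_char R (0, 1) g' -> g = g'.
Proof.
have E1 d : Z22_char R (1, 0) d = (-1) ^+ d.1.
  rewrite /Z22_char -[X in nat_of_ord X]/(1 * d.1 + 0 * d.2).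
  by rewrite mul1r mul0r addr0.
have E2 d : Z22_char R (0, 1) d = (-1) ^+ d.2.
  rewrite /Z22_char -[X in nat_of_ord X]/(0 * d.1 + 1 * d.2).
  by rewrite mul1r mul0r add0r.
case: g g' => [a b] [a' b']; rewrite !E1 !E2 /=.
have sign_inj (c d : 'Z_2) : (-1) ^+ c = (-1) ^+ d :> R -> c = d.
  by case: (Z2P c) => ->; case: (Z2P d) => -> //=;
    rewrite ?expr0 ?expr1 => e; exfalso; move: e; lra.
by move=> /sign_inj -> /sign_inj ->.
Qed.

Lemma Z22_char_sep g g' : g != g' ->
  exists d, Z22_char R g d != Z22_char R g' d.
Proof.
move=> neq; have [e|] := eqVneq (Z22_char R g (1, 0)) (Z22_char R g' (1, 0));
  last by exists (1, 0).
exists (0, 1); apply: contra neq => /eqP e'; apply/eqP.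
by apply: Z22_char_inj2; rewrite ![_ _ g]Z22_charC ![_ _ g']Z22_charC.
Qed.

End Characters.

(** * The standard grading is a Z_2^2-symmetric structure *)

Lemma forall3 (P : 'I_3 -> Prop) : P 0 -> P 1 -> P 2 -> forall i, P i.
Proof.
move=> P0 P1 P2; case=> -[|[|[|//]]] i.
- by rewrite (_ : Ordinal i = 0) //; exact/val_inj.
- by rewrite (_ : Ordinal i = 1) //; exact/val_inj.
- by rewrite (_ : Ordinal i = 2) //; exact/val_inj.
Qed.

Lemma row3P (R : realType) (u v : 'rV[R]_3) :
  u 0 0 = v 0 0 -> u 0 1 = v 0 1 -> u 0 2 = v 0 2 -> u = v.
Proof.
by move=> *; apply/rowP; exact: (@forall3 (fun i => u 0 i = v 0 i)).
Qed.

(** The degree of the i-th basis vector in the standard grading. *)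
Definition weight (i : 'I_3) : Z22 := nth 0 [:: (1, 0); (0, 1); (1, 1)] i.

Section StandardStructure.
Variable R : realType.
Implicit Types u v w : 'rV[R]_3.

(** Membership read off coordinatewise: it makes the grading, eigenspace and
    orthogonality properties below statements about single coordinates. *)
Lemma standard_gradingP g v :
  v \in standard_grading R g <-> (forall i, weight i != g -> v 0 i = 0).
Proof.
have line (j : 'I_3) (W : {vspace 'rV[R]_3}) : W = <['e_j]>%VS ->
    v \in W <-> (forall i, i != j -> v 0 i = 0).
  move=> ->; split=> [/vlineP[k ->] i ij|v0].
    by rewrite !mxE (negbTE ij) mulr0.
  apply/vlineP; exists (v 0 j); apply/rowP => i; rewrite !mxE eqxx /=.
  by case: eqVneq => [->|/v0 ->]; rewrite ?mulr1 ?mulr0.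
case: (Z22P g) => ->; rewrite /standard_grading /=.
- rewrite memv0; split=> [/eqP -> i _|v0]; first by rewrite mxE.
  by apply/eqP/rowP => i; rewrite mxE v0 //; move: i; apply: forall3.
- rewrite (line 0) //; split=> v0; apply: forall3 => // _; exact: v0.
- rewrite (line 1) //; split=> v0; apply: forall3 => // _; exact: v0.
- rewrite (line 2) //; split=> v0; apply: forall3 => // _; exact: v0.
Qed.

Lemma Z22_grading_standard : Z22_grading (standard_grading R).
Proof.
split.
- apply/eqP; rewrite eqEsubv subvf /=; apply/subvP => v _.
  rewrite (row_sum_delta v); apply: memv_suml => i _.
  apply: memvZ; apply: (subvP (sumv_sup (weight i) _ _)) (memv_line _) => //.
  rewrite -memvE; apply/standard_gradingP => j; rewrite mxE eqxx /=.
  by case: (eqVneq j i) => // ->; rewrite eqxx.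
- apply/directv_sum_independent => us usg us0 g _; apply/rowP => i.
  rewrite mxE; have [<-|gi] := eqVneq (weight i) g; last first.
    by have /standard_gradingP := usg g isT; exact.
  move/rowP/(_ i): us0; rewrite summxE mxE (bigD1 (weight i)) //= big1 ?addr0 //.
  move=> d di; have /standard_gradingP := usg d isT; apply; by rewrite eq_sym.
- move=> g g' u v /standard_gradingP ug /standard_gradingP vg.
  apply/standard_gradingP; rewrite h3_bracketE /X3; apply: forall3 => neq;
    rewrite !mxE /= ?mulr0 // mulr1.
  (* The degree of [u, v] differs from that of X3, so in each of the two products
     of the third coordinate one factor has the wrong weight. *)
  have z i j : weight i + weight j = (1, 1) -> u 0 i * v 0 j = 0.
    move=> ij; have [gi|/ug ->] := eqVneq (weight i) g; last by rewrite mul0r.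
    have [gj|/vg ->] := eqVneq (weight j) g'; last by rewrite mulr0.
    by move: neq; rewrite -gi -gj ij eqxx.
  by rewrite !z ?subrr //; congr (_, _); exact/val_inj.
Qed.

Definition diag_scaling (d : Z22) v : 'rV[R]_3 :=
  \row_i (Z22_char R (weight i) d * v 0 i).

Lemma diag_scaling_linear d : linear (diag_scaling d).
Proof. by move=> a u v; apply/rowP => i; rewrite !mxE; ring. Qed.

HB.instance Definition _ d := GRing.isLinear.Build _ _ _ _ (diag_scaling d)
  (diag_scaling_linear d).

Definition standard_embedding d : 'End('rV[R]_3) := linfun (diag_scaling d).

Lemma standard_embeddingE d v i :
  standard_embedding d v 0 i = Z22_char R (weight i) d * v 0 i.
Proof. by rewrite lfunE mxE. Qed.

(** The scaling by d respects the bracket because the weights of X1 and X2 add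
    up to that of X3, and it determines d because those two weights already
    separate the points of Z_2^2. *)
Lemma standard_embeddingP : Z22_embedding standard_embedding.
Proof.
have embD g d : standard_embedding (g + d) =
    (standard_embedding g \o standard_embedding d)%VF.
  apply/lfunP => v; apply/rowP => i.
  by rewrite comp_lfunE !standard_embeddingE Z22_charD mulrA.
split=> // [g|g d gd].
- split=> [|u v].
    have K : cancel (standard_embedding g) (standard_embedding g).
      move=> v; rewrite -comp_lfunE -embD Z22_addxx; apply/rowP => i.
      by rewrite standard_embeddingE Z22_char0 mul1r.
    by exists (standard_embedding g).
  apply/rowP => i; rewrite standard_embeddingE !h3_bracketE.
  rewrite ![in RHS]standard_embeddingE /X3; move: i; apply: forall3;
    rewrite !mxE /= ?mulr0 // !mulr1.
  have -> : Z22_char R (weight 2) g =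
      Z22_char R (weight 0) g * Z22_char R (weight 1) g.
    by rewrite ![Z22_char R (weight _) g]Z22_charC -Z22_charD; congr Z22_char;
      congr (_, _); exact/val_inj.
  ring.
- have sep i : Z22_char R (weight i) g = Z22_char R (weight i) d.
    have := congr1 (fun f : 'End('rV[R]_3) => (f 'e_i : 'rV[R]_3) 0 i) gd.
    by rewrite !standard_embeddingE !mxE !eqxx !mulr1.
  exact: Z22_char_inj2 (sep 0) (sep 1).
Qed.

Lemma standard_grading_symmetric : Z22_symmetric (standard_grading R).
Proof.
split=> //; first exact: Z22_grading_standard.
exists standard_embedding; split; first exact: standard_embeddingP.
move=> g v; split=> [/standard_gradingP vg d|vd].
  apply/rowP => i; rewrite standard_embeddingE mxE.
  by have [->|/vg ->] := eqVneq (weight i) g; rewrite ?mulr0.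
apply/standard_gradingP => i /(Z22_char_sep R)[d neq].
move/rowP/(_ i): (vd d); rewrite standard_embeddingE mxE => /eqP.
by rewrite -subr_eq0 -mulrBl mulf_eq0 subr_eq0 (negbTE neq) => /eqP.
Qed.
End StandardStructure.

(** * Frames adapted to a grading *)

Lemma summands_le1 (x y z : nat) :
  (0 < x -> 0 < y -> 0 < z -> x + (y + z) <= 3 -> [/\ x <= 1, y <= 1 & z <= 1])%N.
Proof. by move=> *; split; lia. Qed.

Section AdaptedBasis.
Variable R : realType.
Implicit Types u v w : 'rV[R]_3.
Variable g : Z22 -> {vspace 'rV[R]_3}.
Hypothesis g_sym : Z22_symmetric g.

Let bracket_linear_l v : linear (fun u => h3_bracket u v).
Proof.
move=> a x y; rewrite !h3_bracketE !mxE scalerA -scalerDl.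
by congr (_ *: _); ring.
Qed.

Let bracket_linear_r u : linear (h3_bracket u).
Proof.
move=> a x y; rewrite !h3_bracketE !mxE scalerA -scalerDl.
by congr (_ *: _); ring.
Qed.

(** Otherwise the bracket, being bilinear, would vanish on the sum of the
    components, which is all of h_3. *)
Lemma homogeneous_noncommuting : exists a b u v,
  [/\ u \in g a, v \in g b & h3_bracket u v != 0].
Proof.
have [[g_full _ _] _ _] := g_sym.
apply: contrapT => no.
have comm a b u v : u \in g a -> v \in g b -> h3_bracket u v = 0.
  by move=> ua vb; apply/eqP/negP => /negP uv; apply: no; exists a, b, u, v.
have ker (f : 'rV[R]_3 -> 'rV[R]_3) : linear f ->
    (forall a u, u \in g a -> f u = 0) -> forall u, f u = 0.
  move=> linf f0 u.
  pose fL : {linear 'rV[R]_3 -> 'rV[R]_3} :=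
    HB.pack f (GRing.isLinear.Build _ _ _ _ _ linf).
  have /memv_sumP[us usg ->] : u \in (\sum_a g a)%VS by rewrite g_full memvf.
  rewrite -[f]/(fL : _ -> _) linear_sum big1 // => a _.
  by apply: (f0 a); exact: usg.
have all0 u v : h3_bracket u v = 0.
  apply: (ker (fun u => h3_bracket u v)) => // a {}u ua.
  by apply: (ker (h3_bracket u)) => // b {}v vb; exact: comm ua vb.
have [e _ _] := h3_bracketX R.
move: (all0 (X1 R) (X2 R)); rewrite e => /rowP/(_ 2).
by rewrite /X3 !mxE /= => /eqP; rewrite oner_eq0.
Qed.

(** The degrees of u, v and [u, v] are non-zero since g_0 = 0, hence pairwise
    distinct.  Three non-trivial components in direct sum exhaust dimension 3,
    so they are lines. *)
Lemma adapted_frame : exists a b u v,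
  [/\ [/\ a != 0, b != 0 & a != b],
      h3_bracket u v != 0 &
      [/\ g a = <[u]>%VS, g b = <[v]>%VS & g (a + b) = <[h3_bracket u v]>%VS]].
Proof.
have [a [b [u [v [ua vb uv]]]]] := homogeneous_noncommuting.
have [[g_full g_dir gM] _ g0] := g_sym.
have nz c w : w \in g c -> w != 0 -> c != 0.
  by move=> wc; apply: contra => /eqP c0; move: wc; rewrite c0 g0 memv0.
have uvab : h3_bracket u v \in g (a + b) := gM _ _ _ _ ua vb.
have u0 : u != 0.
  by apply: contra uv => /eqP ->; rewrite h3_bracketE !mxE !mul0r subrr scale0r.
have v0 : v != 0.
  by apply: contra uv => /eqP ->; rewrite h3_bracketE !mxE !mulr0 subrr scale0r.
have ab : a != b.
  by apply: contraTneq (nz _ _ uvab uv) => ->; rewrite Z22_addxx eqxx.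
have a0 := nz _ _ ua u0; have b0 := nz _ _ vb v0.
exists a, b, u, v; split=> //.
have dim_ge c w : w \in g c -> w != 0 -> (0 < \dim (g c))%N.
  by move=> wc w0; rewrite lt0n dimv_eq0; apply: contra w0 => /eqP e;
    move: wc; rewrite e memv0.
have aab : a + b != a by rewrite -subr_eq0 addrAC subrr add0r.
have bab : a + b != b by rewrite -subr_eq0 addrK.
have dim3 : (\dim (g a) + (\dim (g b) + \dim (g (a + b)%R)) <= 3)%N.
  have : (\dim (\sum_c g c)%VS <= 3)%N by rewrite g_full dimvf.
  apply: leq_trans.
  rewrite (directvP g_dir) /= (bigD1 a) //= leq_add2l (bigD1 b) 1?eq_sym //=.
  by rewrite leq_add2l (bigD1 (a + b)) ?aab //= leq_addr.
have line c w : w \in g c -> w != 0 -> (\dim (g c) <= 1)%N -> g c = <[w]>%VS.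
  move=> wc w0 d1; apply/esym/eqP; rewrite eqEdim -memvE wc /=.
  by rewrite dim_vline w0.
have da := dim_ge _ _ ua u0; have db := dim_ge _ _ vb v0.
have dab := dim_ge _ _ uvab uv.
have [da1 db1 dab1] := summands_le1 da db dab dim3.
by split; exact: line.
Qed.

End AdaptedBasis.

(** * The Lie algebra automorphism defined by a frame *)

Section Frame.
Variable R : realType.
Variables u v : 'rV[R]_3.
Hypothesis uv : h3_bracket u v != 0.
Implicit Types w : 'rV[R]_3.

Definition frame_map w : 'rV[R]_3 :=
  w 0 0 *: u + w 0 1 *: v + w 0 2 *: h3_bracket u v.

Lemma frame_map_linear : linear frame_map.
Proof. by move=> a w w'; apply/rowP => i; rewrite /frame_map !mxE; ring. Qed.

HB.instance Definition _ :=
  GRing.isLinear.Build _ _ _ _ frame_map frame_map_linear.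

Definition frame : 'End('rV[R]_3) := linfun frame_map.

Lemma frameE w : frame w = w 0 0 *: u + w 0 1 *: v + w 0 2 *: h3_bracket u v.
Proof. by rewrite lfunE. Qed.

(** As [u, v] is central, both sides are the same 2 x 2 determinant times
    [u, v]. *)
Lemma frame_bracket w w' :
  frame (h3_bracket w w') = h3_bracket (frame w) (frame w').
Proof.
by rewrite !frameE !h3_bracketE; apply/rowP => i; rewrite /X3 !mxE /=; ring.
Qed.

(** Bracketing a vector of the kernel with v and with u isolates its first two
    coordinates. *)
Lemma frame_inj : injective frame.
Proof.
apply/lker0P; rewrite -subv0; apply/subvP => w.
rewrite memv_ker memv0 => /eqP w0.
have bracket0 x : h3_bracket (frame w) x = 0.
  by rewrite w0 h3_bracketE !mxE !mul0r subrr scale0r.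
have e0 : w 0 0 = 0.
  have : h3_bracket (frame w) v = w 0 0 *: h3_bracket u v.
    by rewrite frameE !h3_bracketE; apply/rowP => i; rewrite /X3 !mxE /=; ring.
  by rewrite bracket0 => /esym/eqP; rewrite scaler_eq0 (negbTE uv) orbF => /eqP.
have e1 : w 0 1 = 0.
  have : h3_bracket (frame w) u = - w 0 1 *: h3_bracket u v.
    by rewrite frameE !h3_bracketE; apply/rowP => i; rewrite /X3 !mxE /=; ring.
  rewrite bracket0 => /esym/eqP; rewrite scaler_eq0 (negbTE uv) orbF oppr_eq0.
  by move/eqP.
have e2 : w 0 2 = 0.
  move/eqP: w0; rewrite frameE e0 e1 !scale0r !add0r scaler_eq0 (negbTE uv) orbF.
  by move/eqP.
by apply/eqP; apply: row3P; rewrite mxE.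
Qed.

Definition coframe : 'End('rV[R]_3) := (frame^-1)%VF.

Lemma frameK : cancel frame coframe.
Proof. by apply: lker0_lfunK; apply/lker0P; exact: frame_inj. Qed.

Lemma coframeK : cancel coframe frame.
Proof. by apply: lker0_lfunVK; apply/lker0P; exact: frame_inj. Qed.

Lemma coframe_bracket w w' :
  coframe (h3_bracket w w') = h3_bracket (coframe w) (coframe w').
Proof. by apply: frame_inj; rewrite frame_bracket !coframeK. Qed.

Lemma coframe_mem w x : (coframe w \in <[x]>%VS) = (w \in <[frame x]>%VS).
Proof.
apply/vlineP/vlineP => -[k e]; exists k.
  by rewrite -[w]coframeK e linearZ.
by rewrite e linearZ /= frameK.
Qed.

Section Pullback.
Variable b : {dot 'rV[R]_3 for idfun}.

Definition pullback w w' := b (frame w) (frame w').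

Lemma pullback_zmodl w' : zmod_morphism (pullback^~ w').
Proof. by move=> x y; rewrite /pullback linearB linearBl. Qed.

Lemma pullback_zmodr w : zmod_morphism (pullback w).
Proof. by move=> x y; rewrite /pullback linearB linearBr. Qed.

Lemma pullback_scalel w' : scalable_for *%R (pullback^~ w').
Proof. by move=> k x; rewrite /pullback linearZ linearZl_LR. Qed.

Lemma pullback_scaler w : scalable_for (idfun \; *%R) (pullback w).
Proof. by move=> k x; rewrite /pullback linearZ linearZr_LR. Qed.

Lemma pullback_sym w w' :
  pullback w w' = (-1) ^+ false * idfun (pullback w' w).
Proof. by rewrite /pullback hermitian_subproof. Qed.

Lemma pullback_gt0 w : w != 0 -> 0 < pullback w w.
Proof.
move=> w0; apply: neq0_dnorm_gt0; apply: contra w0 => /eqP fw0.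
by rewrite -(inj_eq frame_inj) fw0 linear0.
Qed.

Definition pullback_dot : {dot 'rV[R]_3 for idfun} :=
  HB.pack pullback
    (isBilinear.Build _ _ _ _ _ _ pullback
       pullback_zmodl pullback_zmodr pullback_scalel pullback_scaler)
    (isHermitianSesquilinear.Build _ _ false idfun pullback pullback_sym)
    (isDotProduct.Build _ _ pullback pullback_gt0).

Lemma pullback_dotE w w' : pullback_dot w w' = b (frame w) (frame w').
Proof. reflexivity. Qed.
End Pullback.
End Frame.

(** * Smoothness of quadratic maps *)

Section SmoothMaps.
Variable R : realType.

(** A linear map on row vectors is a finite sum of coordinates times constant
    vectors, so it is continuous and is its own differential. *)
Lemma linear_is_diff n (W : normedModType R) (f : 'rV[R]_n -> W) p :
  linear f -> is_diff p f f.
Proof.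
move=> linf.
pose fL : {linear 'rV[R]_n -> W} :=
  HB.pack f (GRing.isLinear.Build _ _ _ _ _ linf).
have fE : fL = \sum_(i < n) (fun q : 'rV[R]_n => q 0 i *: f 'e_i) :> (_ -> _).
  apply/funext => q; rewrite {1}(row_sum_delta q) linear_sum fct_sumE.
  by apply: eq_bigr => i _; rewrite linearZ.
have fC : continuous fL.
  move=> q; apply: differentiable_continuous; rewrite fE.
  apply: differentiable_sum => i; apply: differentiableZl.
  exact: differentiable_coord.
apply: DiffDef; first exact: (@linear_differentiable _ _ _ fL).
exact: (@diff_lin _ _ _ fL).
Qed.

Lemma linear_coord i : linear (fun v : 'rV[R]_3 => v 0 i).
Proof. by move=> a u v; rewrite !mxE. Qed.

Lemma is_diff_class_C n f (df : 'rV[R]_3 -> 'rV[R]_3 -> 'rV[R]_3) :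
  (forall p, is_diff p f (df p)) ->
  (forall v, class_C n (df^~ v)) -> class_C n.+1 f.
Proof.
move=> fdf df_C; split=> [p|v]; first by have [] := fdf p.
rewrite (_ : (fun p => _) = df^~ v) //.
by apply/funext => p; have [_ ->] := fdf p.
Qed.

Lemma is_diff_smooth f (df : 'rV[R]_3 -> 'rV[R]_3 -> 'rV[R]_3) :
  (forall p, is_diff p f (df p)) ->
  (forall v, smooth (df^~ v)) -> smooth f.
Proof.
move=> fdf dfs [|n].
  by move=> p; apply: differentiable_continuous; have [] := fdf p.
by apply: is_diff_class_C fdf _ => v; exact: dfs.
Qed.

Lemma smooth_cst (c : 'rV[R]_3) : smooth (fun=> c).
Proof.
move=> n; elim: n c => [|n IHn] c; first exact: cst_continuous.
by apply: (@is_diff_class_C _ _ (fun _ _ => 0)) => v; exact: IHn.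
Qed.

Lemma smooth_linear (f : 'rV[R]_3 -> 'rV[R]_3) : linear f -> smooth f.
Proof.
move=> linf; apply: (@is_diff_smooth _ (fun=> f)) => [p|v].
  exact: linear_is_diff.
exact: smooth_cst.
Qed.

(** The induction on the order of differentiability has to range over all pairs
    of maps, since it is applied to directional derivatives. *)
Lemma smoothD (f g : 'rV[R]_3 -> 'rV[R]_3) :
  smooth f -> smooth g -> smooth (f + g).
Proof.
move=> fs gs n; elim: n f g fs gs => [|n IHn] f g fs gs.
  by move=> p; apply: continuousD; [exact: (fs 0%N)|exact: (gs 0%N)].
have dfg p : is_diff p (f + g) (fun v => 'd f p v + 'd g p v).
  by apply: is_diffD; apply: differentiableP;
    [exact: proj1 (fs 1%N) p | exact: proj1 (gs 1%N) p].
apply: (is_diff_class_C dfg) => v.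
by apply: (IHn (fun p => 'd f p v) (fun p => 'd g p v)) => m;
  [exact: proj2 (fs m.+1) v | exact: proj2 (gs m.+1) v].
Qed.

Lemma is_diff_quadratic (l m : 'rV[R]_3 -> R) (c : 'rV[R]_3) p :
  linear l -> linear m ->
  is_diff p (fun q => (l q * m q) *: c)
    (fun v => (l p * m v + m p * l v) *: c).
Proof.
move=> linl linm.
have dl := @linear_is_diff _ _ _ p linl; have dm := @linear_is_diff _ _ _ p linm.
have dlm : is_diff p (l * m) (l p *: m + m p *: l) by exact: is_diffM.
have [dlm1 dlm2] := dlm.
apply: DiffDef; first exact: differentiableZl.
by rewrite diffZl // dlm2.
Qed.

(** The directional derivatives of a quadratic map are linear. *)
Lemma smooth_quadratic (l m : 'rV[R]_3 -> R) (c : 'rV[R]_3) :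
  linear l -> linear m -> smooth (fun q => (l q * m q) *: c).
Proof.
move=> linl linm.
apply: is_diff_smooth (fun p => is_diff_quadratic c p linl linm) _ => v.
apply: smooth_linear => a p q.
rewrite linl linm scalerA -scalerDl; congr (_ *: _).
by rewrite /GRing.scale /=; ring.
Qed.
End SmoothMaps.

(** * Integration of Lie algebra endomorphisms of h_3 *)

Section HeisenbergGroup.
Variable R : realType.
Implicit Types p q u v w : 'rV[R]_3.

Lemma H3_mulE p q : H3_mul p q = p + q + (p 0 0 * q 0 1) *: X3 R.
Proof.
rewrite -[RHS]H3_mxK /H3_mul; congr h3_coord.
rewrite /H3_mx mulmxDl mul1mx mulmxDr mulmx1 -!addrA; congr (_ + _).
have -> : h3_mx p *m h3_mx q = (p 0 0 * q 0 1) *: delta_mx 0 2.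
  rewrite /h3_mx !(mulmxDl, mulmxDr) -!scalemxAl -!scalemxAr.
  by rewrite !mul_delta_mx_cond /= !mulr0n mulr1n !scaler0 scalerA !addr0 !add0r.
rewrite /h3_mx /X3 !mxE /= !mulr0 mulr1 !addr0 !scalerDl.
by rewrite !addrA [LHS](ACl (4*1*5*2*6*3*7)).
Qed.

Lemma H3_invE p : H3_inv p = - p + (p 0 0 * p 0 1) *: X3 R.
Proof.
set q := RHS.
have pq1 : H3_mx p *m H3_mx q = 1%:M.
  rewrite -H3_mxM (_ : H3_mul p q = 0).
    by rewrite /H3_mx /h3_mx !mxE !scale0r !addr0.
  by rewrite H3_mulE /q; apply: row3P; rewrite /X3 !mxE /=; ring.
have [pu _] := mulmx1_unit pq1.
by rewrite /H3_inv -[invmx _]mulmx1 -pq1 mulKmx // H3_mxK.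
Qed.

(** Left translations are affine in these coordinates. *)
Lemma maurer_cartanE p v :
  maurer_cartan p v = v - (p 0 0 * v 0 1) *: X3 R.
Proof.
pose L q := q - (p 0 0 * q 0 1) *: X3 R.
have linL : linear L.
  by move=> a u w; apply: row3P; rewrite /L /X3 !mxE /=; ring.
rewrite /maurer_cartan; have -> : H3_mul (H3_inv p) = cst (H3_inv p) + L.
  apply/funext => q; rewrite H3_mulE -[RHS]/(H3_inv p + L q) /L H3_invE.
  by apply: row3P; rewrite /X3 !mxE /=; ring.
have [_ mcE] : is_diff p (cst (H3_inv p) + L) (0 + L).
  by apply: is_diffD; exact: linear_is_diff.
by rewrite mcE add0r.
Qed.

(** Matrix exponential and logarithm in these coordinates: the cube of a strictly
    upper triangular 3 x 3 matrix vanishes, and its square has the single entry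
    w 0 0 * w 0 1. *)
Definition h3_exp w : 'rV[R]_3 := w + (w 0 0 * w 0 1 / 2) *: X3 R.
Definition h3_log p : 'rV[R]_3 := p - (p 0 0 * p 0 1 / 2) *: X3 R.

Lemma h3_expK : cancel h3_exp h3_log.
Proof. by move=> w; apply: row3P; rewrite /h3_exp /h3_log /X3 !mxE /=; ring. Qed.

Lemma h3_logK : cancel h3_log h3_exp.
Proof. by move=> w; apply: row3P; rewrite /h3_exp /h3_log /X3 !mxE /=; ring. Qed.

(** When phi preserves the bracket, this is the endomorphism of the group H_3
    whose differential at the unit is phi. *)
Definition integrate (phi : 'End('rV[R]_3)) p := h3_exp (phi (h3_log p)).

Section Endomorphism.
Variable phi : 'End('rV[R]_3).
Hypothesis phiM : forall u v, phi (h3_bracket u v) = h3_bracket (phi u) (phi v).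

Let phi_lin (i : 'I_3) : linear (fun v => phi v 0 i).
Proof. by move=> a u v; rewrite linearP !mxE. Qed.

(** X3 is a bracket, and every bracket is a multiple of X3. *)
Lemma endo_X3 : exists d, phi (X3 R) = d *: X3 R.
Proof.
have [e _ _] := h3_bracketX R.
by rewrite -{1}e phiM h3_bracketE; eexists.
Qed.

(** Since phi preserves the line of X3, the quadratic correction made by exp only
    sees phi p. *)
Lemma integrateE :
  integrate phi =
    (phi : 'rV[R]_3 -> 'rV[R]_3)
    + (fun p => (phi p 0 0 * phi p 0 1) *: (2^-1 *: X3 R))
    + (fun p => (p 0 0 * p 0 1) *: (- 2^-1 *: phi (X3 R))).
Proof.
apply/funext => p; rewrite /integrate /h3_exp /h3_log linearB linearZ /=.
have [d ->] := endo_X3.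
by apply: row3P; rewrite /X3 !mxE /=; ring.
Qed.

Lemma integrate_is_diff p :
  is_diff p (integrate phi)
    (fun v => phi v
       + (phi p 0 0 * phi v 0 1 + phi p 0 1 * phi v 0 0) *: (2^-1 *: X3 R)
       + (p 0 0 * v 0 1 + p 0 1 * v 0 0) *: (- 2^-1 *: phi (X3 R))).
Proof.
have d1 : is_diff p phi phi.
  by apply: linear_is_diff => a u v; rewrite linearP.
have d2 := is_diff_quadratic (2^-1 *: X3 R) p (phi_lin 0) (phi_lin 1).
have d3 := is_diff_quadratic (- 2^-1 *: phi (X3 R)) p
  (@linear_coord R 0) (@linear_coord R 1).
rewrite integrateE; exact: (is_diffD (is_diffD d1 d2) d3).
Qed.

Lemma integrate_smooth : smooth (integrate phi).
Proof.
rewrite integrateE; apply: smoothD; [apply: smoothD|].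
- by apply: smooth_linear => a u v; rewrite linearP.
- exact: smooth_quadratic.
- by apply: smooth_quadratic; exact: linear_coord.
Qed.

(** The integrated map is a group endomorphism, so it intertwines left
    translations and its differential is phi at every point.  Computing in
    coordinates, the two sides differ by half of the defect of phi in preserving
    the bracket of p and v. *)
Lemma maurer_cartan_integrate p v :
  maurer_cartan (integrate phi p) ('d (integrate phi) p v) =
  phi (maurer_cartan p v).
Proof.
have [_ ->] := integrate_is_diff p.
have [d dE] := endo_X3.
have phiX k : phi (k *: X3 R) = (k * d) *: X3 R.
  by rewrite linearZ /= dE scalerA.
have := congr1 (fun w : 'rV[R]_3 => w 0 2) (phiM p v).
rewrite !maurer_cartanE !h3_bracketE integrateE [phi (v - _)]linearB /=.
rewrite !phiX dE /X3 !mxE /= !mulr1 => pv.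
by apply: row3P; rewrite !mxE /=; lra.
Qed.
End Endomorphism.

Lemma integrate_cancel (phi psi : 'End('rV[R]_3)) :
  cancel phi psi -> cancel (integrate phi) (integrate psi).
Proof. by move=> phiK p; rewrite /integrate h3_expK phiK h3_logK. Qed.

End HeisenbergGroup.

(** * Normal form of the metric *)

Section Isometry.
Variable R : realType.

(** A Lie algebra automorphism that respects the inner products and the gradings
    up to relabelling integrates to an isometry of the left-invariant
    structures. *)
Lemma lie_automorphism_isometric (S S' : Z22_symmetric_riemannian R)
    (phi psi : 'End('rV[R]_3)) (sigma : Z22 -> Z22) :
  (forall u v, phi (h3_bracket u v) = h3_bracket (phi u) (phi v)) ->
  (forall u v, psi (h3_bracket u v) = h3_bracket (psi u) (psi v)) ->
  cancel phi psi -> cancel psi phi ->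
  (forall u v, metric S' (phi u) (phi v) = metric S u v) ->
  bijective sigma -> {morph sigma : c d / c + d} ->
  (forall c v, (phi v \in grading S' (sigma c)) = (v \in grading S c)) ->
  isometric S S'.
Proof.
move=> phiM psiM phiK psiK phi_metric sigma_bij sigmaD phi_grading.
exists (integrate phi); split.
- split; first exact: integrate_smooth.
  exists (integrate psi); split; [exact: integrate_cancel..|].
  exact: integrate_smooth.
- by move=> p v w; rewrite /left_invariant_metric !maurer_cartan_integrate.
- by exists sigma; split=> // p c v; rewrite maurer_cartan_integrate.
Qed.
End Isometry.

Section UnitFrame.
Variable R : realType.

Lemma dot_unit (b : {dot 'rV[R]_3 for idfun}) u :
  u != 0 -> exists2 k, k != 0 & b (k *: u) (k *: u) = 1.
Proof.
move=> u0; have buu : 0 < b u u by exact: neq0_dnorm_gt0.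
exists (Num.sqrt (b u u))^-1.
  by rewrite invr_eq0 gt_eqF // sqrtr_gt0.
rewrite linearZl_LR linearZr_LR /= mulrA -expr2 exprVn sqr_sqrtr ?ltW //.
by rewrite mulVf // gt_eqF.
Qed.

(** Rescaling u and v also rescales [u, v] and changes none of the three
    lines. *)
Lemma orthonormal_adapted_frame (M : Z22_symmetric_riemannian R) :
  exists (a b : Z22) (u v : 'rV[R]_3),
  [/\ [/\ a != 0, b != 0 & a != b],
      [/\ metric M u u = 1 & metric M v v = 1],
      h3_bracket u v != 0 &
      [/\ grading M a = <[u]>%VS, grading M b = <[v]>%VS &
          grading M (a + b) = <[h3_bracket u v]>%VS]].
Proof.
have [a [b [u [v [ab uv [ga gb gab]]]]]] := adapted_frame (gradingP M).
have u0 : u != 0.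
  by apply: contra uv => /eqP ->; rewrite h3_bracketE !mxE !mul0r subrr scale0r.
have v0 : v != 0.
  by apply: contra uv => /eqP ->; rewrite h3_bracketE !mxE !mulr0 subrr scale0r.
have [k k0 ku] := dot_unit (metric M) u0.
have [l l0 lv] := dot_unit (metric M) v0.
have brE : h3_bracket (k *: u) (l *: v) = (k * l) *: h3_bracket u v.
  by rewrite !h3_bracketE scalerA !mxE; congr (_ *: _); ring.
have lineZ c w : c != 0 -> <[w]>%VS = <[c *: w]>%VS :> {vspace 'rV[R]_3}.
  move=> c0; apply/eqP; rewrite eqEsubv -!memvE memvZ ?memv_line // andbT.
  by apply/vlineP; exists c^-1; rewrite scalerA mulVf // scale1r.
exists a, b, (k *: u), (l *: v); split.
- exact: ab.
- by split.
- by rewrite brE scaler_eq0 negb_or uv andbT mulf_neq0.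
- by rewrite brE -!lineZ ?mulf_neq0.
Qed.
End UnitFrame.

Theorem theorem18 (R : realType) (M : Z22_symmetric_riemannian R) :
  exists (M' : Z22_symmetric_riemannian R) (lambda : R),
    [/\ lambda != 0,
        forall gamma, grading M' gamma = standard_grading R gamma,
        forall u v, metric M' u v =
          omega1 u * omega1 v + omega2 u * omega2 v
          + lambda ^+ 2 * (omega3 u * omega3 v) &
        isometric M M'].
Proof.
have [a [b [u [v [[a0 b0 ab] [uu vv] uv [ga gb gab]]]]]] :=
  orthonormal_adapted_frame M.
set w := h3_bracket u v in uv gab.
have ww : 0 < metric M w w by exact: neq0_dnorm_gt0.
pose lambda := Num.sqrt (metric M w w).
have lambda2 : lambda ^+ 2 = metric M w w by rewrite sqr_sqrtr // ltW.
have aab : a + b != a by rewrite -subr_eq0 addrAC subrr add0r.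
have bab : a + b != b by rewrite -subr_eq0 addrK.
have ab0 : a + b != 0.
  apply: contra ab => /eqP e.
  by rewrite -[b]addr0 -(Z22_addxx a) addrCA [b + a]addrC e addr0.
have orth (c d : Z22) x y : c != 0 -> d != 0 -> c != d ->
    grading M c = <[x]>%VS -> grading M d = <[y]>%VS ->
    metric M x y = 0 /\ metric M y x = 0.
  move=> c0 d0 cd gc gd.
  split; [apply: (@metric_orthogonal _ M c d) |
    apply: (@metric_orthogonal _ M d c)]; by rewrite // ?gc ?gd ?memv_line // eq_sym.
have [uv0 vu0] := orth _ _ _ _ a0 b0 ab ga gb.
have [wu0 uw0] := orth _ _ _ _ ab0 a0 aab gab ga.
have [wv0 vw0] := orth _ _ _ _ ab0 b0 bab gab gb.
pose g' : {dot 'rV[R]_3 for idfun} := pullback_dot uv (metric M).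
have mDl x y z : metric M (x + y) z = metric M x z + metric M y z.
  exact: linearDl.
have mDr x y z : metric M x (y + z) = metric M x y + metric M x z.
  exact: linearDr.
have mZ k l x y : metric M (k *: x) (l *: y) = k * (l * metric M x y).
  by rewrite linearZl_LR linearZr_LR.
have g'E x y : g' x y = omega1 x * omega1 y + omega2 x * omega2 y
    + lambda ^+ 2 * (omega3 x * omega3 y).
  rewrite pullback_dotE !frameE -/w !mDl !mDr !mZ.
  rewrite uu vv uv0 vu0 wu0 uw0 wv0 vw0 lambda2 /omega1 /omega2 /omega3.
  ring.
have g'_orth c d x y : c != 0 -> d != 0 -> c != d ->
    x \in standard_grading R c -> y \in standard_grading R d -> g' x y = 0.
  move=> _ _ cd /standard_gradingP xc /standard_gradingP yd; rewrite g'E.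
  have z i : x 0 i * y 0 i = 0.
    have [ic|/xc ->] := eqVneq (weight i) c; last by rewrite mul0r.
    by rewrite yd ?mulr0 // ic.
  by rewrite /omega1 /omega2 /omega3 !z mulr0 !addr0.
pose M' := {| grading := standard_grading R; metric := g';
  gradingP := standard_grading_symmetric R; metric_orthogonal := g'_orth |}.
exists M', lambda; split=> //; first by rewrite gt_eqF // sqrtr_gt0.
apply: (@lie_automorphism_isometric _ _ _ (coframe u v) (frame u v)
  (Z22_coord a b)).
- exact: coframe_bracket.
- exact: frame_bracket.
- exact: coframeK.
- exact: frameK.
- by move=> x y; rewrite -[LHS]/(g' _ _) pullback_dotE !coframeK.
- by exists (Z22_combine a b); [exact: Z22_coordK | exact: Z22_combineK].
- exact: Z22_coordD.
- move=> c x /=; rewrite -[in RHS](Z22_coordK a0 b0 ab c).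
  have Xu : frame u v 'e_0 = u.
    by rewrite frameE !mxE /= !scale0r scale1r !addr0.
  have Xv : frame u v 'e_1 = v.
    by rewrite frameE !mxE /= !scale0r scale1r !addr0 add0r.
  have Xw : frame u v 'e_2 = w.
    by rewrite frameE !mxE /= !scale0r scale1r !add0r.
  have [cE0 cEa cEb cEab] := Z22_combineE a b.
  have [_ _ g0] := gradingP M.
  case: (Z22P (Z22_coord a b c)) => ->; rewrite /standard_grading /=.
  + by rewrite cE0 g0 !memv0 -(can_eq (frameK uv)) coframeK // linear0.
  + by rewrite cEa ga coframe_mem // Xu.
  + by rewrite cEb gb coframe_mem // Xv.
  + by rewrite cEab gab coframe_mem // Xw.
Qed.
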